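(* Consider an RBM with observed variables $X\in\{-1,1\}^n$ as in the context. Fix $\delta>0$, $\epsilon>0$, $\zeta>0$. Suppose that for every observed variable $u$ we are given a set $n(u)$ which is a subset of the MRF neighborhood of $u$ and contains every $i$ for which there is $T\subseteq[n]$ with $u,i\in T$ and $|\hat f(T)|\ge\zeta$. Suppose that we are given $M$ i.i.d. samples of $X$ from the RBM and run the regression procedure of the context at each $u$. There is an absolute constant $C>0$ such that if \[M\ge C\,\gamma^2\ln(8\cdot n\cdot 2^D/\delta)/\epsilon^2\quad\text{and}\quad\zeta\le\frac{\sqrt\epsilon}{\psi\sqrt{1+e^{2\gamma}}},\] then with probability at least $1-\delta$, for all observed variables $u$, \[\mathbb{E}\big[(\mathbb{P}(X_u=1|X_{[n]\setminus\{u\}})-\sigma(\hat w_u\cdot z_u))^2\big]\le\epsilon,\] where the expectation is over $X$ drawn from the marginal of the RBM (with $\hat w_u$ fixed) and $z_u$ is the feature vector of $X$ at $u$.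
   Context: RBM: $\mathbb{P}(X=x,Y=y)\propto\exp(x^TJy+h^Tx+g^Ty)$ over observed $X\in\{-1,1\}^n$ and latent $Y\in\{-1,1\}^m$. The marginal of $X$ is $\propto\exp(f(x))$, $f(x)=\sum_j\rho(J_j\cdot x+g_j)+h^Tx$, $\rho(t)=\log(e^t+e^{-t})$, $J_j$ the $j$-th column of $J$; $f=\sum_{T\subseteq[n]}\hat f(T)\chi_T$, $\chi_T(x)=\prod_{i\in T}x_i$. MRF neighborhood of $u$: all $i\ne u$ with $\hat f(T)\ne0$ for some $T\ni u,i$. $D$: max size of an MRF neighborhood; $\gamma=\max_u\sum_{T\ni u}|\hat f(T)|$; $\psi:=\max_{u\in[n]}|\{T\subseteq[n]:u\in T,\ \hat f(T)\ne0\}|$. $\sigma(t)=1/(1+e^{-t})$. Regression at $u$: feature vector $z_u=(\chi_T(X))_{T\subseteq n(u)}\in\{-1,1\}^{2^{|n(u)|}}$, label $y=X_u$; from samples $(z^{(k)},y^{(k)})_{k=1}^M$, $\hat w_u\in\arg\min\{\frac1M\sum_{k=1}^M\ln(1+e^{-y^{(k)}(w\cdot z^{(k)})}):w\in\mathbb{R}^{2^{|n(u)|}},\ \|w\|_1\le2\gamma\}$. *)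

(* Defs.v *)
From HB Require Import structures.
From mathcomp Require Import all_boot all_order all_algebra.
From mathcomp Require Import all_classical all_reals all_analysis.
Set Implicit Arguments. Unset Strict Implicit. Unset Printing Implicit Defensive.
Import Order.TTheory GRing.Theory Num.Theory.
Local Open Scope ring_scope.

(* Spin vectors: a configuration in {-1,1}^n is a boolean finite function,
   true |-> 1, false |-> -1. *)
Notation cube n := {ffun 'I_n -> bool}.

Definition spin {R : pzRingType} (b : bool) : R := if b then 1 else -1.

Section RBM.
Variables (R : realType) (n m : nat).
Variables (J : 'I_n -> 'I_m -> R) (h : 'I_n -> R) (g : 'I_m -> R).

Definition rbm_weight (x : cube n) (y : cube m) : R :=
  expR (\sum_i \sum_j spin (x i) * J i j * spin (y j)
        + \sum_i h i * spin (x i) + \sum_j g j * spin (y j)).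

Definition rbm_Z : R := \sum_(x : cube n) \sum_(y : cube m) rbm_weight x y.

Definition rbm_marg (x : cube n) : R := (\sum_(y : cube m) rbm_weight x y) / rbm_Z.

Definition rho (t : R) : R := ln (expR t + expR (- t)).

Definition chi (T : {set 'I_n}) (x : cube n) : R := \prod_(i in T) spin (x i).

Definition rbm_f (x : cube n) : R :=
  \sum_j rho (\sum_i J i j * spin (x i) + g j) + \sum_i h i * spin (x i).

Definition fhat (T : {set 'I_n}) : R :=
  (2 ^+ n)^-1 * \sum_(x : cube n) rbm_f x * chi T x.

Definition mrf_nbhd (u : 'I_n) : {set 'I_n} :=
  [set i | (i != u) &&
     [exists T : {set 'I_n}, [&& u \in T, i \in T & fhat T != 0]]].

Definition rbm_D : nat := \max_(u < n) #|mrf_nbhd u|.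

Definition rbm_gamma : R :=
  (\big[Num.max/0]_(u < n) (\sum_(T : {set 'I_n} | u \in T) `|fhat T|))%R.

Definition rbm_psi : nat :=
  \max_(u < n) #|[set T : {set 'I_n} | (u \in T) && (fhat T != 0%R)]|.

Definition setx (x : cube n) (u : 'I_n) (b : bool) : cube n :=
  [ffun i => if i == u then b else x i].

Definition condp (u : 'I_n) (x : cube n) : R :=
  rbm_marg (setx x u true) / (rbm_marg (setx x u true) + rbm_marg (setx x u false)).

(* weight vectors indexed by the subsets T of n(u); entries at other T are ignored *)
Definition dotz (nu : {set 'I_n}) (w : {set 'I_n} -> R) (x : cube n) : R :=
  \sum_(T : {set 'I_n} | T \subset nu) w T * chi T x.

Definition l1w (nu : {set 'I_n}) (w : {set 'I_n} -> R) : R :=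
  \sum_(T : {set 'I_n} | T \subset nu) `|w T|.

Definition emp_loss (M : nat) (nu : {set 'I_n}) (u : 'I_n)
    (s : {ffun 'I_M -> cube n}) (w : {set 'I_n} -> R) : R :=
  M%:R^-1 * \sum_(k < M) ln (1 + expR (- (spin (s k u) * dotz nu w (s k)))).

Definition is_erm (M : nat) (nu : {set 'I_n}) (u : 'I_n) (rad : R)
    (s : {ffun 'I_M -> cube n}) (w : {set 'I_n} -> R) : Prop :=
  l1w nu w <= rad /\
  forall w' : {set 'I_n} -> R, l1w nu w' <= rad -> emp_loss nu u s w <= emp_loss nu u s w'.

Definition sigmoid (t : R) : R := (1 + expR (- t))^-1.

Definition pred_err (nu : {set 'I_n}) (u : 'I_n) (w : {set 'I_n} -> R) : R :=
  \sum_(x : cube n) rbm_marg x * (condp u x - sigmoid (dotz nu w x)) ^+ 2.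

Definition sample_prob (M : nat) (E : {ffun 'I_M -> cube n} -> Prop) : R :=
  \sum_(s : {ffun 'I_M -> cube n} | `[< E s >]) \prod_(k < M) rbm_marg (s k).

End RBM.

(* Main.v *)
(** The conditional law of [X_u] is logistic with the coefficients [2 * fhat T],
    [T] containing [u], so the excess logistic risk of a weight vector is the
    mean of a Bregman divergence of [softplus], which dominates twice the squared
    prediction error.  Dropping the coefficients outside [n(u)] moves the log-odds
    by at most [2 * zeta * psi] and costs at most [eps / 4] of risk.

    The deviation of the empirical excess risk is controlled through its
    exponential moment.  The sample space being finite, it is enough to take the
    maximum over one bad weight vector per bad sample.  Coordinate by coordinate,
    symmetrization and the Ledoux-Talagrand contraction replace the loss by the
    linear form; on an l1 ball this is governed by the [2 * 2 ^ #|n(u)|] vertices,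
    each with a sub-Gaussian moment, and Markov's inequality followed by a union
    bound over [u] concludes with [C = 128]. *)

Require Import Defs.
From mathcomp Require Import all_boot all_order all_algebra.
From mathcomp Require Import all_classical all_reals all_analysis.
From mathcomp Require Import ring lra.
Set Implicit Arguments. Unset Strict Implicit. Unset Printing Implicit Defensive.
Import Order.TTheory GRing.Theory Num.Theory.
Import numFieldNormedType.Exports.
Local Open Scope ring_scope.

(** * Finite probability spaces *)

Section FiniteProbability.
Variable R : numFieldType.

Definition is_pmf (X : finType) (mu : X -> R) : Prop :=
  (forall x, 0 <= mu x) /\ \sum_x mu x = 1.

Definition mean (X : finType) (mu F : X -> R) : R := \sum_x mu x * F x.

Definition proba (X : finType) (mu : X -> R) (B : pred X) : R := \sum_(x | B x) mu x.

Definition coin (b : bool) : R := 2^-1.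

Definition prod_pmf (X Y : finType) (mu : X -> R) (nu : Y -> R) (p : X * Y) : R :=
  mu p.1 * nu p.2.

Definition iid (X : finType) (mu : X -> R) (M : nat) (s : {ffun 'I_M -> X}) : R :=
  \prod_(k < M) mu (s k).
Arguments iid {X} mu M s.

Section Mean.
Variables (X : finType) (mu : X -> R).
Implicit Types (F G : X -> R) (B : pred X).

Lemma eq_mean F G : F =1 G -> mean mu F = mean mu G.
Proof. by move=> FG; apply: eq_bigr => x _; rewrite FG. Qed.

Lemma meanD F G : mean mu (fun x => F x + G x) = mean mu F + mean mu G.
Proof. by rewrite -big_split; apply: eq_bigr => x _; rewrite mulrDr. Qed.

Lemma meanZ c F : mean mu (fun x => c * F x) = c * mean mu F.
Proof. by rewrite mulr_sumr; apply: eq_bigr => x _; rewrite mulrCA. Qed.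

Lemma meanB F G : mean mu (fun x => F x - G x) = mean mu F - mean mu G.
Proof. by rewrite -sumrB; apply: eq_bigr => x _; rewrite mulrBr. Qed.

Lemma mean_sum (I : finType) (P : pred I) (F : I -> X -> R) :
  mean mu (fun x => \sum_(i | P i) F i x) = \sum_(i | P i) mean mu (F i).
Proof. by rewrite exchange_big/=; apply: eq_bigr => x _; rewrite mulr_sumr. Qed.

Hypothesis mu_pmf : is_pmf mu.

Lemma mean_cst c : mean mu (fun=> c) = c.
Proof. by rewrite /mean -mulr_suml mu_pmf.2 mul1r. Qed.

Lemma ler_mean F G : (forall x, F x <= G x) -> mean mu F <= mean mu G.
Proof. by move=> FG; apply: ler_sum => x _; rewrite ler_wpM2l ?mu_pmf.1. Qed.

Lemma mean_ge0 F : (forall x, 0 <= F x) -> 0 <= mean mu F.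
Proof. by move=> F0; rewrite -[0]mean_cst; apply: ler_mean. Qed.

Lemma mean_le_cst c F : (forall x, F x <= c) -> mean mu F <= c.
Proof. by move=> Fc; rewrite -[leRHS]mean_cst; apply: ler_mean. Qed.

Lemma markov_mean c B F : (forall x, 0 <= F x) -> (forall x, B x -> c <= F x) ->
  proba mu B * c <= mean mu F.
Proof.
move=> F0 Fc; rewrite mulr_suml big_mkcond; apply: ler_sum => x _.
by case: ifP => [/Fc ?|_]; rewrite ?mulr_ge0 ?ler_wpM2l ?mu_pmf.1.
Qed.

Lemma proba_union_bound (I : finType) (bad : I -> pred X) (good : pred X) :
  (forall x, ~~ good x -> exists i, bad i x) ->
  1 - \sum_i proba mu (bad i) <= proba mu good.
Proof.
move=> goodN; rewrite lerBlDr -mu_pmf.2 (bigID good)/= lerD2l.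
rewrite (exchange_big_dep xpredT)//= big_mkcond; apply: ler_sum => x _.
case: ifPn => [/goodN[i bad_i]|_]; last by rewrite sumr_ge0// => i _; apply: mu_pmf.1.
by rewrite (bigD1 i)//= lerDl sumr_ge0// => j _; apply: mu_pmf.1.
Qed.

Lemma proba_union_bound_uniform (I : finType) (bad : I -> pred X) (good : pred X) d :
  0 <= d -> (forall i, proba mu (bad i) <= d / #|I|%:R) ->
  (forall x, ~~ good x -> exists i, bad i x) -> 1 - d <= proba mu good.
Proof.
move=> d0 bad_le goodN; apply: le_trans (proba_union_bound goodN); rewrite lerB//.
apply: le_trans (ler_sum _ (fun i _ => bad_le i)) _; rewrite sumr_const -[leLHS]mulr_natr.
by have [->|I0] := eqVneq (#|I|%:R : R) 0; rewrite ?mulr0 ?divfK.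
Qed.

End Mean.

Section Products.
Variables (X Y : finType) (mu : X -> R) (nu : Y -> R).

Lemma exchange_mean (F : X -> Y -> R) :
  mean mu (fun x => mean nu (F x)) = mean nu (fun y => mean mu (F^~ y)).
Proof. by rewrite [LHS]mean_sum; apply: eq_bigr => y _; rewrite meanZ. Qed.

Lemma mean_prod_pmf (F : X * Y -> R) :
  mean (prod_pmf mu nu) F = mean mu (fun x => mean nu (fun y => F (x, y))).
Proof.
rewrite /mean; under [RHS]eq_bigr do rewrite mulr_sumr.
by rewrite pair_bigA; apply: eq_bigr => -[x y] _; rewrite mulrA.
Qed.

Hypotheses (mu_pmf : is_pmf mu) (nu_pmf : is_pmf nu).

Lemma is_pmf_prod : is_pmf (prod_pmf mu nu).
Proof.
split=> [p|]; first by rewrite mulr_ge0 ?mu_pmf.1 ?nu_pmf.1.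
rewrite -(pair_bigA _ (fun x y => mu x * nu y))/= -mu_pmf.2.
by apply: eq_bigr => x _; rewrite -mulr_sumr nu_pmf.2 mulr1.
Qed.

End Products.

Lemma mean_coin (F : bool -> R) : mean coin F = (F true + F false) / 2.
Proof. by rewrite /mean big_bool/= -mulrDr mulrC. Qed.

Lemma is_pmf_coin : is_pmf coin.
Proof. by split=> [b|]; [rewrite invr_ge0|rewrite big_bool [RHS]splitr mul1r]. Qed.

Section Samples.
Variables (X : finType) (mu : X -> R).

Definition fcons M (x : X) (s : {ffun 'I_M -> X}) : {ffun 'I_M.+1 -> X} :=
  [ffun k => oapp s x (unlift ord0 k)].

Lemma fcons0 M x (s : {ffun 'I_M -> X}) : fcons x s ord0 = x.
Proof. by rewrite ffunE unlift_none. Qed.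

Lemma fconsS M x (s : {ffun 'I_M -> X}) k : fcons x s (lift ord0 k) = s k.
Proof. by rewrite ffunE liftK. Qed.

Lemma sum_fcons (V : nmodType) M x (s : {ffun 'I_M -> X}) (c : X -> V) :
  \sum_k c (fcons x s k) = c x + \sum_k c (s k).
Proof.
by rewrite big_ord_recl fcons0; congr +%R; apply: eq_bigr => k _; rewrite fconsS.
Qed.

Lemma iid_fcons M x (s : {ffun 'I_M -> X}) : iid mu M.+1 (fcons x s) = mu x * iid mu M s.
Proof.
by rewrite /iid big_ord_recl fcons0; congr *%R; apply: eq_bigr => k _; rewrite fconsS.
Qed.

Lemma mean_iidS M (F : {ffun 'I_M.+1 -> X} -> R) :
  mean (iid mu M.+1) F = mean mu (fun x => mean (iid mu M) (fun s => F (fcons x s))).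
Proof.
rewrite -[RHS](mean_prod_pmf mu (iid mu M) (fun p => F (fcons p.1 p.2))).
rewrite /mean (reindex (fun p : X * {ffun 'I_M -> X} => fcons p.1 p.2))/=.
  by apply: eq_bigr => -[x s] _; rewrite iid_fcons.
exists (fun s => (s ord0, [ffun k => s (lift ord0 k)])) => [[x s] _|s _] /=.
  by rewrite fcons0; congr pair; apply/ffunP => k; rewrite ffunE fconsS.
by apply/ffunP => k; rewrite ffunE; case: unliftP => [j ->|->]/=; rewrite ?ffunE.
Qed.

Lemma mean_iid_prod M (F : X -> R) :
  mean (iid mu M) (fun s => \prod_k F (s k)) = mean mu F ^+ M.
Proof.
rewrite -[in RHS](card_ord M) -prodr_const bigA_distr_bigA/=.
by apply: eq_bigr => s _; rewrite -big_split.
Qed.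

Lemma is_pmf_iid M : is_pmf mu -> is_pmf (iid mu M).
Proof.
move=> [mu0 mu1]; split=> [s|]; first exact: prodr_ge0.
by rewrite -(bigA_distr_bigA (fun=> mu)) big1.
Qed.

End Samples.
End FiniteProbability.
Arguments coin {R} b.
Arguments iid {R X} mu M s.

(** * The logistic function *)

Section Logistic.
Variable R : realType.
Implicit Types a b t x : R.

Lemma derive_sign_min (f df : R -> R) a b :
  (forall x, is_derive x 1 f (df x)) ->
  (forall x, 0 <= df x * (x - a)) -> f a <= f b.
Proof.
move=> fdf dfa.
have cf c d : {within `[c, d], continuous f}%classic.
  by apply: derivable_within_continuous => x _; apply: ex_derive.
have [ab|ba|->//] := ltgtP a b.
- have [c] := MVT ab (fun x _ => fdf x) (cf a b).
  rewrite in_itv/= => /andP[ac _] fab.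
  have := dfa c; rewrite pmulr_lge0 ?subr_gt0// => df0.
  by rewrite -subr_ge0 fab mulr_ge0// subr_ge0 ltW.
- have [c] := MVT ba (fun x _ => fdf x) (cf b a).
  rewrite in_itv/= => /andP[_ ca] fab.
  have := dfa c; rewrite nmulr_lge0 ?subr_lt0// => df0.
  by rewrite -subr_le0 fab mulr_le0_ge0// subr_ge0 ltW.
Qed.

Definition softplus t : R := ln (1 + expR t).

Definition softplus_bregman a b : R := softplus b - softplus a - sigmoid a * (b - a).

Lemma addr1_expR_gt0 t : 0 < 1 + expR t.
Proof. by rewrite addr_gt0 ?expR_gt0. Qed.

#[local] Instance is_derive_softplus t : is_derive t 1 softplus (sigmoid t).
Proof.
have dln := is_derive1_ln (addr1_expR_gt0 t).
have dexp : is_derive t 1 (fun x : R => 1 + expR x) (expR t).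
  by apply: is_derive_eq; ring.
have <- : (1 + expR t)^-1 * expR t = sigmoid t.
  rewrite /sigmoid expRN; have := expR_gt0 t => t0.
  by field; rewrite ?lt0r_neq0 ?addr_gt0.
exact: (@is_derive1_comp _ _ (fun x : R => 1 + expR x) _ _ _ dln dexp).
Qed.

#[local] Instance is_derive_sigmoid t :
  is_derive t 1 (@sigmoid R) (sigmoid t * (1 - sigmoid t)).
Proof.
have t0 := lt0r_neq0 (addr1_expR_gt0 (- t)).
have dexp : is_derive t 1 (fun x : R => 1 + expR (- x)) (- expR (- t)).
  by apply: is_derive_eq; ring.
have dinv := @is_deriveV _ (fun x : R => 1 + expR (- x)) _ _ _ t0 dexp.
by apply: is_derive_eq; rewrite /sigmoid /GRing.scale/=; field.
Qed.

Lemma sigmoid_increment a b :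
  0 <= (sigmoid b - sigmoid a) * (b - a) <= (b - a) ^+ 2 / 4.
Proof.
wlog ab : a b / a <= b.
  move=> incr; have [/incr//|/ltW/incr] := leP a b.
  by rewrite -mulrNN !opprB -(sqrrN (b - a)) opprB.
have [|c _ ->] := MVT_segment ab (fun x _ => is_derive_sigmoid x).
  by apply: derivable_within_continuous => x _; apply: ex_derive.
have slope : 0 <= sigmoid c * (1 - sigmoid c) <= 1 / 4.
  have sigmoid0 : 0 <= sigmoid c by rewrite invr_ge0 ltW ?addr1_expR_gt0.
  have sigmoid1 : sigmoid c <= 1.
    by rewrite invf_le1 ?addr1_expR_gt0// lerDl expR_ge0.
  by have := sqr_ge0 (1 - 2 * sigmoid c); nra.
by have := sqr_ge0 (b - a); rewrite -mulrA -expr2; nra.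
Qed.

Lemma softplus_bregman_le a b : softplus_bregman a b <= (b - a) ^+ 2 / 8.
Proof.
pose f x := (x - a) ^+ 2 / 8 - softplus_bregman a x.
have fa0 : f a = 0 by rewrite /f /softplus_bregman; ring.
suff : f a <= f b by rewrite fa0 subr_ge0.
apply: (@derive_sign_min _ (fun x => (x - a) / 4 - (sigmoid x - sigmoid a))) => x.
  by apply: is_derive_eq; rewrite /GRing.scale/=; field.
by have /andP[] := sigmoid_increment a x; nra.
Qed.

Lemma softplus_bregman_ge a b :
  2 * (sigmoid b - sigmoid a) ^+ 2 <= softplus_bregman a b.
Proof.
pose f x := softplus_bregman a x - 2 * (sigmoid x - sigmoid a) ^+ 2.
have fa0 : f a = 0 by rewrite /f /softplus_bregman; ring.
suff : f a <= f b by rewrite fa0 subr_ge0.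
apply: (@derive_sign_min _
  (fun x => (sigmoid x - sigmoid a) * (1 - 2 * sigmoid x) ^+ 2)) => x.
  by apply: is_derive_eq; rewrite /GRing.scale/=; ring.
by rewrite mulrAC mulr_ge0 ?sqr_ge0//; have /andP[] := sigmoid_increment a x.
Qed.

Lemma softplusN t : softplus (- t) = softplus t - t.
Proof.
rewrite /softplus -{3}(expRK t) -ln_div ?posrE ?addr1_expR_gt0 ?expR_gt0//.
by congr ln; rewrite expRN; field; rewrite lt0r_neq0 ?expR_gt0.
Qed.

Lemma softplus_lip a b : `|softplus a - softplus b| <= `|a - b|.
Proof.
wlog ab : a b / b <= a.
  by move=> lip; have [/lip//|/ltW/lip] := leP b a; rewrite distrC (distrC b).
rewrite !ger0_norm ?subr_ge0//; last first.
  by rewrite ler_ln ?posrE ?addr1_expR_gt0// lerD2l ler_expR.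
rewrite lerBlDr -(expRK (a - b)) -lnM ?posrE ?addr1_expR_gt0 ?expR_gt0//.
rewrite ler_ln ?posrE ?mulr_gt0 ?addr1_expR_gt0 ?expR_gt0//.
by rewrite mulrDr mulr1 -expRD subrK lerD2r -expR0 ler_expR subr_ge0.
Qed.

(* [ln (cosh x)] is the Bregman divergence of [softplus] between [0] and [2 * x]. *)
Lemma cosh_le_expR_sqr x : (expR x + expR (- x)) / 2 <= expR (x ^+ 2 / 2).
Proof.
have -> : (expR x + expR (- x)) / 2 = expR (softplus_bregman 0 (2 * x)).
  rewrite /softplus_bregman subr0 /softplus /sigmoid oppr0 expR0.
  have -> : (1 + 1)^-1 * (2 * x) = x by field.
  have -> : 2 * x = x + x by ring.
  rewrite !expRB !lnK ?posrE ?addr1_expR_gt0// expRD expRN.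
  by field; rewrite lt0r_neq0 ?expR_gt0.
by rewrite ler_expR (le_trans (softplus_bregman_le _ _))// subr0; nra.
Qed.

End Logistic.

(** * Contraction of exponential maxima *)

Section ExponentialConvexity.
Variable R : realType.
Implicit Types a b c p q s t : R.

Lemma expR_mean_le (X : finType) (mu F : X -> R) : is_pmf mu ->
  expR (mean mu F) <= mean mu (fun x => expR (F x)).
Proof.
move=> mu_pmf; set m := mean mu F.
have -> : expR m = mean mu (fun x => expR m * (1 + (F x - m))).
  by rewrite meanZ meanD meanB !mean_cst// subrr addr0 mulr1.
apply: ler_mean => // x; rewrite -[in leRHS](subrKC m (F x)) expRD.
by rewrite ler_wpM2l ?expR_ge0 ?expR_ge1Dx.
Qed.

Lemma expR_increment_le a b c d :
  b <= a -> b <= d -> d - b <= c - a -> expR d - expR b <= expR c - expR a.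
Proof.
have incrE x y : expR y - expR x = expR x * (expR (y - x) - 1).
  by rewrite mulrBr mulr1 -expRD subrKC.
move=> ba bd dbca; rewrite !incrE ler_pM ?expR_ge0 ?ler_expR//.
  by rewrite subr_ge0 -expR0 ler_expR subr_ge0.
by rewrite lerB ?ler_expR.
Qed.

Lemma expR_sym_mono c p t : `|p| <= `|t| ->
  expR (c + p) + expR (c - p) <= expR (c + t) + expR (c - t).
Proof.
have normE x : expR (c + x) + expR (c - x) = expR (c + `|x|) + expR (c - `|x|).
  by case: ger0P => // _; rewrite opprK addrC.
move=> pt; rewrite (normE p) (normE t).
have p0 := normr_ge0 p.
have := @expR_increment_le (c + `|p|) (c - `|t|) (c + `|t|) (c - `|p|); lra.
Qed.

Lemma expR_contraction_nneg a b t s p q : 0 <= s -> s <= t ->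
  `|p| <= t -> `|q| <= s -> `|p - q| <= t - s ->
  expR (a + p) + expR (b - q) <=
  Num.max (expR (a + t)) (expR (b + s)) + Num.max (expR (a - t)) (expR (b - s)).
Proof.
move=> s0 st pt qs; rewrite ler_norml => /andP[_ pqts].
have [_ sq] := ler_normlP _ _ qs.
have [bsap|apbs] := leP (b - s) (a + p).
- apply: (@le_trans _ _ (expR (a + t) + expR (b - s))).
    by have := @expR_increment_le (a + p) (b - s) (a + t) (b - q); lra.
  by rewrite lerD// le_max lexx ?orbT.
- apply: (@le_trans _ _ (expR (b + s) + expR (b - s))).
    apply: (@le_trans _ _ (expR (b + q) + expR (b - q))).
      by rewrite lerD2r ler_expR; have [] := ler_normlP _ _ qs; lra.
    by apply: expR_sym_mono; rewrite (ger0_norm s0).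
  by rewrite lerD// le_max lexx orbT.
Qed.

(* The two-point case of the Ledoux-Talagrand contraction principle. *)
Lemma expR_contraction a b t s p q :
  `|p| <= `|t| -> `|q| <= `|s| -> `|p - q| <= `|t - s| ->
  expR (a + p) + expR (b - q) <=
  Num.max (expR (a + t)) (expR (b + s)) + Num.max (expR (a - t)) (expR (b - s)).
Proof.
wlog t0 : t s / 0 <= t => [contr pt qs pqts|].
  have [/contr->//|t0] := leP 0 t.
  rewrite [leRHS]addrC; have := contr (- t) (- s).
  by rewrite -opprD !normrN !opprK oppr_ge0 ltW//; apply.
move=> pt qs pqts; rewrite (ger0_norm t0) in pt.
have [s0|s0] := leP 0 s; last first.
  rewrite (ltr0_norm s0) in qs.
  apply: lerD; rewrite le_max !ler_expR !lerD2l.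
  - by rewrite (le_trans (ler_norm p)).
  - by rewrite (le_trans _ qs) ?orbT// -normrN ler_norm.
rewrite (ger0_norm s0) in qs.
have [st|ts] := leP s t.
  by apply: expR_contraction_nneg; rewrite // -(ger0_norm (x := t - s)) ?subr_ge0.
rewrite addrC maxC (maxC (expR (a - t))).
have := @expR_contraction_nneg b a s t (- q) (- p); rewrite !normrN opprK; apply=> //.
  exact: ltW.
by rewrite addrC (le_trans pqts)// ltr0_norm ?subr_lt0// opprB.
Qed.

End ExponentialConvexity.

Section MaxExp.
Variables (R : realType) (I : finType).
Implicit Types A B p t : I -> R.

Definition maxexp A : R := \big[Num.max/0]_i expR (A i).

Lemma expR_le_maxexp A i : expR (A i) <= maxexp A.
Proof. exact: (le_bigmax 0 (fun j => expR (A j))). Qed.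

Lemma maxexp_le A (c : R) : 0 <= c -> (forall i, expR (A i) <= c) -> maxexp A <= c.
Proof. by move=> c0 Ac; apply: bigmax_le. Qed.

Lemma maxexp_ge0 A : 0 <= maxexp A.
Proof. exact: bigmax_ge_id. Qed.

Lemma eq_maxexp A B : A =1 B -> maxexp A = maxexp B.
Proof. by move=> AB; apply: eq_bigr => i _; rewrite AB. Qed.

Lemma maxexp_add_le A B (c : R) : 0 <= c ->
  (forall i j, expR (A i) + expR (B j) <= c) -> maxexp A + maxexp B <= c.
Proof.
move=> c0 AB; rewrite -lerBrDr; apply: maxexp_le => [|i].
  rewrite subr_ge0; apply: maxexp_le => // j.
  by apply: le_trans (AB j j); rewrite lerDr expR_ge0.
rewrite lerBrDr addrC -lerBrDr; apply: maxexp_le => [|j].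
  by rewrite subr_ge0; apply: le_trans (AB i i); rewrite lerDl expR_ge0.
by rewrite lerBrDr addrC.
Qed.

Lemma maxexp_mean_le (X : finType) (mu : X -> R) (F : X -> I -> R) : is_pmf mu ->
  maxexp (fun i => mean mu (F^~ i)) <= mean mu (fun x => maxexp (F x)).
Proof.
move=> mu_pmf; apply: maxexp_le => [|i].
  by apply: mean_ge0 => // x; apply: maxexp_ge0.
apply: le_trans (expR_mean_le _ mu_pmf) _.
by apply: ler_mean => // x; apply: expR_le_maxexp.
Qed.

Lemma maxexp_midpoint_le A B :
  maxexp (fun i => (A i + B i) / 2) <= (maxexp A + maxexp B) / 2.
Proof.
have := @maxexp_mean_le bool coin (fun b => if b then A else B) (is_pmf_coin R).
by rewrite mean_coin (eq_maxexp (fun i => mean_coin _)).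
Qed.

End MaxExp.

Definition contracted (R : numDomainType) (I : Type) (p t : I -> R) : Prop :=
  (forall i, `|p i| <= `|t i|) /\ (forall i j, `|p i - p j| <= `|t i - t j|).

Lemma contractedZ (R : numDomainType) (I : Type) (c : R) (p t : I -> R) :
  contracted p t -> contracted (fun i => c * p i) (fun i => c * t i).
Proof.
move=> [pt pt_diff]; split=> [i|i j]; first by rewrite !normrM ler_wpM2l.
by rewrite -!mulrBr !normrM ler_wpM2l.
Qed.

Section Symmetrization.
Variables (R : realType) (I : finType).
Implicit Types A p t : I -> R.

Lemma mean_coin_maxexp A t :
  mean coin (fun b => maxexp (fun i => A i + spin b * t i)) =
  (maxexp (fun i => A i + t i) + maxexp (fun i => A i - t i)) / 2.
Proof.
by rewrite mean_coin; congr ((_ + _) / 2); apply: eq_maxexp => i;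
  rewrite ?mul1r ?mulN1r.
Qed.

Lemma maxexp_contraction A p t : contracted p t ->
  mean coin (fun b => maxexp (fun i => A i + spin b * p i)) <=
  mean coin (fun b => maxexp (fun i => A i + spin b * t i)).
Proof.
move=> [pt pt_diff]; rewrite !mean_coin_maxexp ler_pM2r ?invr_gt0//.
apply: maxexp_add_le => [|i j]; first by rewrite addr_ge0 ?maxexp_ge0.
apply: le_trans (expR_contraction (A i) (A j) (pt i) (pt j) (pt_diff i j)) _.
have leD := expR_le_maxexp (fun i => A i + t i).
have leB := expR_le_maxexp (fun i => A i - t i).
apply: lerD; rewrite ge_max; apply/andP; split.
1,2: exact: leD.
1,2: exact: leB.
Qed.

Variables (X : finType) (mu : X -> R).
Hypothesis mu_pmf : is_pmf mu.

Lemma maxexp_symmetrization (l : X -> I -> R) A :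
  mean mu (fun x => maxexp (fun i => A i + (mean mu (l^~ i) - l x i))) <=
  mean mu (fun x => mean coin (fun b => maxexp (fun i => A i + spin b * (2 * l x i)))).
Proof.
apply: (@le_trans _ _ (mean mu (fun x => mean mu (fun y =>
    maxexp (fun i => A i + (l y i - l x i)))))).
  apply: ler_mean => // x; apply: le_trans (maxexp_mean_le _ mu_pmf).
  by under [leRHS]eq_maxexp do rewrite meanD meanB !mean_cst//.
pose half_max b x := maxexp (fun i => A i + spin b * (2 * l x i)) / 2.
apply: (@le_trans _ _ (mean mu (fun x => mean mu (fun y =>
    half_max true y + half_max false x)))).
  apply: ler_mean => // x; apply: ler_mean => // y.
  rewrite -mulrDl; apply: le_trans (maxexp_midpoint_le _ _).
  by rewrite (eq_maxexp (B := fun i => A i + (l y i - l x i)))// => i; rewrite /spin; field.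
under eq_mean do rewrite meanD mean_cst//.
under [leRHS]eq_mean do rewrite mean_coin mulrDl.
by rewrite !meanD mean_cst.
Qed.

Lemma maxexp_symmetrization_contraction (l t : X -> I -> R) A :
  (forall x, contracted (l x) (t x)) ->
  mean mu (fun x => maxexp (fun i => A i + (mean mu (l^~ i) - l x i))) <=
  mean (prod_pmf mu coin) (fun y => maxexp (fun i => A i + spin y.2 * (2 * t y.1 i))).
Proof.
move=> l_contr; rewrite mean_prod_pmf; apply: le_trans (maxexp_symmetrization l A) _.
apply: ler_mean => //= x.
apply: (@maxexp_contraction A (fun i => 2 * l x i) (fun i => 2 * t x i)).
exact: contractedZ (l_contr x).
Qed.

End Symmetrization.

Lemma maxexp_tensorization (R : realType) (I X Y : finType) (mu : X -> R) (nu : Y -> R)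
    (a : X -> I -> R) (b : Y -> I -> R) (M : nat) (A : I -> R) :
  is_pmf mu -> is_pmf nu ->
  (forall A, mean mu (fun x => maxexp (fun i => A i + a x i)) <=
             mean nu (fun y => maxexp (fun i => A i + b y i))) ->
  mean (iid mu M) (fun s => maxexp (fun i => A i + \sum_k a (s k) i)) <=
  mean (iid nu M) (fun s => maxexp (fun i => A i + \sum_k b (s k) i)).
Proof.
move=> mu_pmf nu_pmf ab; elim: M A => [|M IH] A.
  have mean_empty (Z : finType) (om : Z -> R) (c : Z -> I -> R) : is_pmf om ->
      mean (iid om 0) (fun s => maxexp (fun i => A i + \sum_k c (s k) i)) = maxexp A.
    move=> om_pmf; rewrite -[RHS](mean_cst (is_pmf_iid 0 om_pmf)).
    by apply: eq_mean => s; apply: eq_maxexp => i; rewrite big_ord0 addr0.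
  by rewrite !mean_empty.
have maxexp_fcons (Z : finType) (c : Z -> I -> R) z (s : {ffun 'I_M -> Z}) :
    maxexp (fun i => A i + \sum_k c (fcons z s k) i) =
    maxexp (fun i => A i + c z i + \sum_k c (s k) i).
  by apply: eq_maxexp => i; rewrite (sum_fcons _ _ (c^~ i)) addrA.
rewrite !mean_iidS.
apply: (@le_trans _ _ (mean mu (fun x => mean (iid nu M) (fun s =>
    maxexp (fun i => A i + a x i + \sum_k b (s k) i))))).
  by apply: ler_mean => // x; under eq_mean do rewrite maxexp_fcons; apply: IH.
rewrite exchange_mean [leRHS]exchange_mean; apply: ler_mean => [|s].
  exact: is_pmf_iid.
have maxexp_swap (Z : finType) (c : Z -> I -> R) z :
    maxexp (fun i => A i + c z i + \sum_k b (s k) i) =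
    maxexp (fun i => A i + \sum_k b (s k) i + c z i).
  by apply: eq_maxexp => i; rewrite addrAC.
under eq_mean do rewrite maxexp_swap.
under [leRHS]eq_mean do rewrite maxexp_fcons maxexp_swap.
exact: ab.
Qed.

(** * Uniform deviations over an l1 ball *)

Section LinearForms.
Variables (R : numDomainType) (K : finType) (F : {set K}).
Implicit Types v w z : K -> R.

Definition dot v z : R := \sum_(k in F) v k * z k.

Definition l1norm v : R := \sum_(k in F) `|v k|.

Lemma dotBl v w z : dot (fun k => v k - w k) z = dot v z - dot w z.
Proof. by rewrite -sumrB; apply: eq_bigr => k _; rewrite mulrBl. Qed.

Lemma dotZl c v z : dot (fun k => c * v k) z = c * dot v z.
Proof. by rewrite mulr_sumr; apply: eq_bigr => k _; rewrite mulrA. Qed.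

Lemma dotZr c v z : dot v (fun k => c * z k) = c * dot v z.
Proof. by rewrite mulr_sumr; apply: eq_bigr => k _; rewrite mulrCA. Qed.

Lemma l1normB v w : l1norm (fun k => v k - w k) <= l1norm v + l1norm w.
Proof. by rewrite -big_split; apply: ler_sum => k _; apply: ler_normB. Qed.

Lemma l1normZ c v : l1norm (fun k => c * v k) = `|c| * l1norm v.
Proof. by rewrite mulr_sumr; apply: eq_bigr => k _; rewrite normrM. Qed.

Lemma norm_dot_le v z c : (forall k, k \in F -> `|z k| <= c) ->
  `|dot v z| <= l1norm v * c.
Proof.
move=> zc; apply: le_trans (ler_norm_sum _ _ _) _; rewrite mulr_suml.
by apply: ler_sum => k kF; rewrite normrM ler_wpM2l ?zc.
Qed.

End LinearForms.

Section Rademacher.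
Variables (R : realType) (X K : finType) (mu : X -> R) (F : {set K}).
Hypothesis mu_pmf : is_pmf mu.

Definition rademacher_sum (M : nat) (z : X -> R) (s : {ffun 'I_M -> X * bool}) : R :=
  \sum_k spin (s k).2 * z (s k).1.

Lemma rademacher_sum_dot M (v : K -> R) (z : X -> K -> R) (s : {ffun 'I_M -> X * bool}) :
  rademacher_sum (fun x => dot F v (z x)) s = dot F v (fun k => rademacher_sum (z^~ k) s).
Proof.
rewrite /rademacher_sum; under eq_bigr do rewrite -dotZr.
by rewrite exchange_big; apply: eq_bigr => k _; rewrite -mulr_sumr.
Qed.

Lemma mean_expR_rademacher_sum_le M (z : X -> R) (c : R) : (forall x, `|z x| <= 1) ->
  mean (iid (prod_pmf mu coin) M) (fun s => expR (c * rademacher_sum z s)) <=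
  expR (M%:R * (c ^+ 2 / 2)).
Proof.
move=> z1.
have -> : mean (iid (prod_pmf mu coin) M) (fun s => expR (c * rademacher_sum z s)) =
    mean (prod_pmf mu coin) (fun y => expR (c * (spin y.2 * z y.1))) ^+ M.
  by rewrite -mean_iid_prod; apply: eq_mean => s; rewrite mulr_sumr expR_sum.
rewrite mean_prod_pmf expRM_natl lerXn2r ?nnegrE ?expR_ge0//.
  apply: mean_ge0 => // x; apply: mean_ge0 (is_pmf_coin R) _ _ => b.
  exact: expR_ge0.
apply: mean_le_cst => // x; rewrite mean_coin/= mul1r mulN1r mulrN.
apply: le_trans (cosh_le_expR_sqr _) _; rewrite ler_expR ler_pM2r ?invr_gt0//.
by rewrite exprMn ler_piMr ?sqr_ge0// -real_normK ?num_real// exprn_ile1.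
Qed.

Lemma expR_dot_le (v G : K -> R) (r : R) : F != finset.set0 -> l1norm F v <= r ->
  expR (dot F v G) <= \sum_(k in F) (expR (r * G k) + expR (- r * G k)).
Proof.
move=> /set0Pn[k0 Fk0] vr.
have [j Fj maxj] := @arg_maxP _ _ _ k0 (mem F) (fun k => `|G k|) Fk0.
apply: (@le_trans _ _ (expR (r * G j) + expR (- r * G j))); last first.
  rewrite (bigD1 j)//= lerDl; apply: sumr_ge0 => k _.
  by rewrite addr_ge0// expR_ge0.
have : dot F v G <= r * `|G j|.
  rewrite (le_trans (ler_norm _))// (le_trans (norm_dot_le _ maxj))//.
  by rewrite ler_wpM2r.
rewrite -ler_expR => /le_trans; apply.
by case: ger0P => _; rewrite ?mulrN -?mulNr ?lerDl ?lerDr expR_ge0.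
Qed.

Lemma mean_maxexp_rademacher_le (I : finType) (v : I -> K -> R) (z : X -> K -> R)
    (r : R) M :
  F != finset.set0 -> (forall i, l1norm F (v i) <= r) -> (forall x k, `|z x k| <= 1) ->
  mean (iid (prod_pmf mu coin) M)
    (fun s => maxexp (fun i => rademacher_sum (fun x => dot F (v i) (z x)) s)) <=
  2 * #|F|%:R * expR (M%:R * (r ^+ 2 / 2)).
Proof.
move=> F0 vr z1.
have signed_pmf := is_pmf_iid M (is_pmf_prod mu_pmf (is_pmf_coin R)).
pose G k s : R := @rademacher_sum M (z^~ k) s.
apply: (@le_trans _ _ (mean (iid (prod_pmf mu coin) M)
    (fun s => \sum_(k in F) (expR (r * G k s) + expR (- r * G k s))))).
  apply: ler_mean => // s; apply: maxexp_le => [|i].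
    by apply: sumr_ge0 => k _; rewrite addr_ge0// expR_ge0.
  by rewrite rademacher_sum_dot expR_dot_le.
rewrite mean_sum.
apply: (@le_trans _ _ (\sum_(k in F) 2 * expR (M%:R * (r ^+ 2 / 2)))).
  apply: ler_sum => k _; rewrite meanD mulr_natl mulr2n -{2}(sqrrN r).
  by rewrite lerD// mean_expR_rademacher_sum_le.
by rewrite sumr_const -[leLHS]mulr_natr mulrAC.
Qed.

End Rademacher.

Section UniformDeviation.
Variables (R : realType) (X K : finType) (mu : X -> R) (F : {set K}) (z : X -> K -> R).
Hypothesis mu_pmf : is_pmf mu.
Hypotheses (F0 : F != finset.set0) (z1 : forall x k, `|z x k| <= 1).

Lemma mean_maxexp_deviation_le (I : finType) (v : I -> K -> R) (l : X -> I -> R) (r : R) M :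
  (forall i, l1norm F (v i) <= r) ->
  (forall x, contracted (l x) (fun i => dot F (v i) (z x))) ->
  mean (iid mu M) (fun s => maxexp (fun i => \sum_k (mean mu (l^~ i) - l (s k) i))) <=
  2 * #|F|%:R * expR (M%:R * ((2 * r) ^+ 2 / 2)).
Proof.
move=> vr l_contr.
have v2r i : l1norm F (fun k => 2 * v i k) <= 2 * r.
  by rewrite l1normZ ger0_norm// ler_pM2l.
apply: le_trans (mean_maxexp_rademacher_le mu_pmf M F0 v2r z1).
have signed_pmf := is_pmf_prod mu_pmf (is_pmf_coin R).
have sym A := maxexp_symmetrization_contraction mu_pmf A l_contr.
have := maxexp_tensorization M (fun=> 0) mu_pmf signed_pmf sym.
congr (_ <= _); apply: eq_mean => s; apply: eq_maxexp => i; rewrite add0r//.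
by apply: eq_bigr => k _; rewrite dotZl.
Qed.

Lemma uniform_deviation (I : Type) (v : I -> K -> R) (l : X -> I -> R) (r eps : R) M
    (B : pred {ffun 'I_M -> X}) :
  0 < r -> 0 <= eps -> (forall i, l1norm F (v i) <= r) ->
  (forall x, contracted (l x) (fun i => dot F (v i) (z x))) ->
  (forall s, B s -> exists i, M%:R * eps <= \sum_k (mean mu (l^~ i) - l (s k) i)) ->
  proba (iid mu M) B <= 2 * #|F|%:R * expR (- (M%:R * eps ^+ 2 / (8 * r ^+ 2))).
Proof.
move=> r0 eps0 vr l_contr Bdev.
have [sel selP] := choice (fun s : {s | B s} => Bdev (val s) (valP s)).
pose lam := eps / (4 * r ^+ 2).
have lam0 : 0 <= lam by rewrite divr_ge0// mulr_ge0// sqr_ge0.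
have -> : - (M%:R * eps ^+ 2 / (8 * r ^+ 2)) =
    M%:R * ((2 * (lam * r)) ^+ 2 / 2) - lam * (M%:R * eps).
  by rewrite /lam; field; rewrite lt0r_neq0.
rewrite expRB mulrA ler_pdivlMr ?expR_gt0//.
apply: le_trans (mean_maxexp_deviation_le (v := fun i k => lam * v (sel i) k)
  (l := fun x i => lam * l x (sel i)) M _ _) => [|i|x].
- apply: markov_mean => [|s|s Bs]; first exact: is_pmf_iid.
    exact: maxexp_ge0.
  apply: le_trans (expR_le_maxexp _ (exist _ s Bs)); rewrite ler_expR.
  under eq_bigr do rewrite meanZ -mulrBr.
  by rewrite -mulr_sumr ler_wpM2l// (selP (exist _ s Bs)).
- by rewrite l1normZ ger0_norm// ler_wpM2l.
- have [] := contractedZ lam (l_contr x).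
  by split=> [i|i j]; rewrite !dotZl.
Qed.

End UniformDeviation.

(** * Fourier analysis on the cube *)

Section Cube.
Variables (R : realType) (n : nat).
Implicit Types (T nu : {set 'I_n}) (x y : cube n) (u : 'I_n) (w : {set 'I_n} -> R).

Lemma spin_sqr (b : bool) : spin b * spin b = 1 :> R.
Proof. by case: b; rewrite /spin ?mulr1// mulrNN mulr1. Qed.

Lemma norm_spin (b : bool) : `|spin b| = 1 :> R.
Proof. by case: b; rewrite /spin ?normrN normr1. Qed.

Lemma norm_chi T x : `|chi R T x| = 1.
Proof. by rewrite /chi normr_prod big1// => i _; rewrite norm_spin. Qed.

Lemma setx_id x u : setx x u (x u) = x.
Proof. by apply/ffunP => i; rewrite ffunE; case: eqP => [->|]. Qed.

Lemma setx_at x u b : setx x u b u = b.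
Proof. by rewrite ffunE eqxx. Qed.

Lemma setx_setx x u b c : setx (setx x u b) u c = setx x u c.
Proof. by apply/ffunP => i; rewrite !ffunE; case: eqP. Qed.

Lemma chi_setx_notin T x u b : u \notin T -> chi R T (setx x u b) = chi R T x.
Proof.
move=> uT; apply: eq_bigr => i iT; rewrite ffunE; case: eqP => // iu.
by rewrite -iu iT in uT.
Qed.

Lemma chi_setx T x u b : u \in T ->
  chi R T (setx x u b) = spin b * chi R (T :\ u) x.
Proof.
move=> uT; rewrite -(chi_setx_notin x b (T := T :\ u) (u := u)) ?setD11//.
by rewrite /chi (big_setD1 u)//= setx_at.
Qed.

Lemma sum_chi_chi x y : \sum_T chi R T y * chi R T x = (x == y)%:R * 2 ^+ n.
Proof.
transitivity (\prod_(i < n) (spin (y i) * spin (x i) + 1) : R).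
  rewrite bigA_distr; apply: eq_bigr => T _.
  by rewrite -big_mkcond /chi big_split.
have [->|x_neq_y] := eqVneq x y.
  by rewrite mul1r (eq_bigr (fun=> 2)) ?prodr_const ?card_ord// => i _; rewrite spin_sqr.
have /existsP[i xyi] : [exists i, x i != y i].
  rewrite -negb_forall; apply: contra x_neq_y => /forallP xy.
  by apply/eqP/ffunP => i; apply/eqP.
rewrite mul0r (bigD1 i)//=; move: xyi; rewrite /spin.
by case: (x i); case: (y i) => //= _; rewrite ?mulr1 ?mul1r addrC subrr mul0r.
Qed.

Lemma cube_fourier_inversion (F : cube n -> R) x :
  \sum_T ((2 ^+ n)^-1 * \sum_y F y * chi R T y) * chi R T x = F x.
Proof.
under eq_bigr do rewrite -mulrA mulr_suml.
rewrite -mulr_sumr exchange_big/=.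
under eq_bigr => y _.
  under eq_bigr do rewrite -mulrA.
  rewrite -mulr_sumr sum_chi_chi; over.
rewrite (bigD1 x)//= eqxx mul1r big1 ?addr0; last first.
  by move=> y yx; rewrite eq_sym (negbTE yx) mul0r mulr0.
by rewrite mulrCA mulVf ?mulr1// expf_neq0.
Qed.

Lemma sum_setx (F : cube n -> R) u :
  \sum_x (F (setx x u true) + F (setx x u false)) = 2 * \sum_x F x.
Proof.
pose flip x := setx x u (~~ x u).
have flipK : involutive flip.
  by move=> x; rewrite /flip setx_at negbK setx_setx setx_id.
rewrite mulr_natl mulr2n [X in _ = _ + X](reindex_inj (inv_inj flipK))/= -big_split/=.
apply: eq_bigr => x _; rewrite /flip -{3}(setx_id x u).
by case: (x u) => //=; rewrite addrC.
Qed.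

Lemma sum_subset_setU1 nu u (F : {set 'I_n} -> R) : u \notin nu ->
  \sum_(S : {set 'I_n} | S \subset nu) F S =
  \sum_(T : {set 'I_n} | (u \in T) && (T :\ u \subset nu)) F (T :\ u).
Proof.
move=> unu; rewrite (reindex_onto (fun T => T :\ u) (fun S => u |: S)); last first.
  move=> S Snu; rewrite setU1K//.
  by apply: contra unu; apply: (fintype.subsetP Snu).
apply: eq_bigl => T; rewrite andbC; congr (_ && _).
have [uT|uT] := boolP (u \in T); first by rewrite finset.setD1K// eqxx.
by apply/eqP => E; move: uT; rewrite -E setU11.
Qed.

Lemma dotz_setx nu u w x b :
  u \notin nu -> dotz nu w (setx x u b) = dotz nu w x.
Proof.
move=> unu; apply: eq_bigr => T Tnu; rewrite chi_setx_notin//.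
by apply: contra unu; apply: (fintype.subsetP Tnu).
Qed.

Lemma dotzE nu w x : dotz nu w x = dot (powerset nu) w (fun T => chi R T x).
Proof. by apply: eq_bigl => T; rewrite powersetE. Qed.

Lemma l1wE nu w : l1w nu w = l1norm (powerset nu) w.
Proof. by apply: eq_bigl => T; rewrite powersetE. Qed.

Lemma norm_dotz_le nu w x : `|dotz nu w x| <= l1w nu w.
Proof.
by rewrite dotzE l1wE -[leRHS]mulr1 norm_dot_le// => T _; rewrite norm_chi.
Qed.

End Cube.

(** * Logistic regression on the cube *)

Lemma expRN_le_invr (R : realType) (a e q t : R) : 0 < a -> 0 < e -> 0 < q ->
  a * ln q / e <= t -> expR (- (t * e / a)) <= q^-1.
Proof.
move=> a0 e0 q0; rewrite ler_pdivrMr// => aqte.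
rewrite expRN lef_pV2 ?posrE ?expR_gt0// -[leLHS]lnK ?posrE// ler_expR.
by rewrite ler_pdivlMr// mulrC.
Qed.

Section LogisticRegression.
Variables (R : realType) (n : nat) (mu : cube n -> R) (nu : {set 'I_n}) (u : 'I_n).
Implicit Types (w : {set 'I_n} -> R) (x : cube n).

Definition logistic_loss w x : R := softplus (- (spin (x u) * dotz nu w x)).

Definition risk w : R := mean mu (logistic_loss w).

Definition signed_feature x (T : {set 'I_n}) : R := spin (x u) * chi R T x.

Lemma dot_signed_feature w x :
  dot (powerset nu) w (signed_feature x) = spin (x u) * dotz nu w x.
Proof. by rewrite dotZr dotzE. Qed.

Lemma logistic_loss_lip w w' x :
  `|logistic_loss w x - logistic_loss w' x| <= `|dotz nu w x - dotz nu w' x|.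
Proof.
apply: le_trans (softplus_lip _ _) _.
by rewrite -opprD normrN -mulrBr normrM norm_spin mul1r.
Qed.

Lemma contracted_logistic_loss (w' : {set 'I_n} -> R) x :
  contracted (fun w => logistic_loss w x - logistic_loss w' x)
    (fun w => dot (powerset nu) (fun T => w T - w' T) (signed_feature x)).
Proof.
split=> [w|w1 w2]; rewrite !dotBl !dot_signed_feature -!mulrBr normrM norm_spin mul1r.
  exact: logistic_loss_lip.
by rewrite !opprB !addrA !subrK; apply: logistic_loss_lip.
Qed.

Lemma emp_lossE M (s : {ffun 'I_M -> cube n}) w :
  emp_loss nu u s w = M%:R^-1 * \sum_k logistic_loss w (s k).
Proof. by []. Qed.

Lemma erm_sum_le M (rad : R) (s : {ffun 'I_M -> cube n}) w w' :
  is_erm nu u rad s w -> l1w nu w' <= rad ->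
  \sum_k logistic_loss w (s k) <= \sum_k logistic_loss w' (s k).
Proof.
move=> [_ min_w] /min_w; rewrite !emp_lossE.
case: M s {min_w} => [|M] s; first by rewrite !big_ord0.
by rewrite ler_pM2l// invr_gt0 ltr0n.
Qed.

Hypothesis mu_pmf : is_pmf mu.

Lemma excess_risk_le w w' : risk w - risk w' <= l1w nu w + l1w nu w'.
Proof.
rewrite /risk -meanB; apply: mean_le_cst => // x.
rewrite (le_trans (ler_norm _))// (le_trans (logistic_loss_lip _ _ _))//.
by rewrite (le_trans (ler_normB _ _))// lerD ?norm_dotz_le.
Qed.

Variables (rad eps : R) (w' : {set 'I_n} -> R).
Hypotheses (eps0 : 0 < eps) (w'_rad : l1w nu w' <= rad).

Definition erm_suboptimal {M : nat} (s : {ffun 'I_M -> cube n}) : bool :=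
  `[< exists w, is_erm nu u rad s w /\ eps <= risk w - risk w' >].

Lemma erm_suboptimal_rad_gt0 M (s : {ffun 'I_M -> cube n}) : erm_suboptimal s -> 0 < rad.
Proof.
move=> /asboolP[w [[w_rad _] eps_le]].
by have := eps0; have := w'_rad; have := excess_risk_le w w'; lra.
Qed.

Lemma erm_suboptimal_deviation M (s : {ffun 'I_M -> cube n}) : erm_suboptimal s ->
  exists w : {w | l1w nu w <= rad}, M%:R * eps <=
    \sum_k (mean mu (fun x => logistic_loss (val w) x - logistic_loss w' x) -
            (logistic_loss (val w) (s k) - logistic_loss w' (s k))).
Proof.
move=> /asboolP[w [erm_w eps_le]]; exists (exist _ w erm_w.1) => /=.
rewrite meanB big_split/= sumr_const card_ord sumrN sumrB -[leLHS]subr0.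
apply: lerB; last by rewrite subr_le0 (erm_sum_le erm_w).
by rewrite -[leRHS]mulr_natl ler_wpM2l.
Qed.

Lemma proba_erm_suboptimal_le M (q : R) : 0 < q ->
  32 * rad ^+ 2 * ln q / eps ^+ 2 <= M%:R ->
  proba (iid mu M) erm_suboptimal <= 2 * 2 ^+ #|nu| / q.
Proof.
move=> q0 M_large.
have [/existsP[s0 /erm_suboptimal_rad_gt0 rad0]|/existsPn never] :=
  boolP [exists s, @erm_suboptimal M s]; last first.
  rewrite /proba big_pred0 => [|s]; last exact: negbTE.
  by rewrite divr_ge0 ?mulr_ge0 ?exprn_ge0// ltW.
apply: (@le_trans _ _ (2 * 2 ^+ #|nu| * expR (- (M%:R * eps ^+ 2 / (8 * (2 * rad) ^+ 2))))).
  rewrite -natrX -card_powerset.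
  apply: (@uniform_deviation _ _ _ _ _ signed_feature _ _ _
    {w | l1w nu w <= rad} (fun v T => val v T - w' T)
    (fun x v => logistic_loss (val v) x - logistic_loss w' x)) => //.
  - by apply/set0Pn; exists finset.set0; rewrite powersetE finset.sub0set.
  - by move=> x T; rewrite normrM norm_spin norm_chi mulr1.
  - by rewrite mulr_gt0.
  - exact: ltW.
  - move=> [w w_rad]; rewrite (le_trans (l1normB _ _ _))// -!l1wE mulr_natl mulr2n.
    exact: lerD.
  - move=> x; have [contr_norm contr_diff] := contracted_logistic_loss w' x.
    by split=> [w|w1 w2]; [apply: contr_norm|apply: contr_diff].
  - exact: erm_suboptimal_deviation.
have -> : 8 * (2 * rad) ^+ 2 = 32 * rad ^+ 2 by ring.
rewrite ler_pM2l ?mulr_gt0 ?exprn_gt0//.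
by apply: expRN_le_invr M_large; rewrite ?mulr_gt0 ?exprn_gt0.
Qed.

End LogisticRegression.

(** * Conditional laws of a restricted Boltzmann machine *)

Section RBM.
Variables (R : realType) (n m : nat).
Variables (J : 'I_n -> 'I_m -> R) (h : 'I_n -> R) (g : 'I_m -> R).
Implicit Types (T nu : {set 'I_n}) (x : cube n) (u : 'I_n) (w : {set 'I_n} -> R).
Local Notation f := (rbm_f J h g).
Local Notation fhat := (fhat J h g).
Local Notation mu := (rbm_marg J h g).
Local Notation Z := (rbm_Z J h g).
Local Notation condp := (condp J h g).
Local Notation gamma := (rbm_gamma J h g).
Local Notation psi := (rbm_psi J h g).

Lemma sum_rbm_weight x : \sum_y rbm_weight J h g x y = expR (f x).
Proof.
pose field j := \sum_i J i j * spin (x i) + g j.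
have weightE (y : cube m) : rbm_weight J h g x y =
    (\prod_j expR (field j * spin (y j))) * expR (\sum_i h i * spin (x i)).
  rewrite -expR_sum -expRD /rbm_weight; congr expR.
  rewrite addrAC exchange_big -big_split/=; congr (_ + _).
  apply: eq_bigr => j _; rewrite mulrDl mulr_suml; congr (_ + _).
  by apply: eq_bigr => i _; rewrite (mulrC (J i j)).
under eq_bigr do rewrite weightE.
rewrite -mulr_suml -(bigA_distr_bigA (fun j b => expR (field j * spin b))).
rewrite /rbm_f expRD expR_sum; congr (_ * _); apply: eq_bigr => j _.
by rewrite big_bool/= /spin mulr1 mulrN1 /rho lnK// posrE addr_gt0 ?expR_gt0.
Qed.

Lemma rbm_Z_gt0 : 0 < Z.
Proof.
rewrite /rbm_Z; under eq_bigr do rewrite sum_rbm_weight.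
rewrite (bigD1 [ffun=> true])//= ltr_wpDr ?expR_gt0//.
by apply: sumr_ge0 => *; apply: expR_ge0.
Qed.

Lemma rbm_margE x : mu x = expR (f x) / Z.
Proof. by rewrite /rbm_marg sum_rbm_weight. Qed.

Lemma rbm_marg_gt0 x : 0 < mu x.
Proof. by rewrite rbm_margE divr_gt0 ?expR_gt0 ?rbm_Z_gt0. Qed.

Lemma is_pmf_rbm_marg : is_pmf mu.
Proof.
split=> [x|]; first exact/ltW/rbm_marg_gt0.
by rewrite -mulr_suml divff// lt0r_neq0// rbm_Z_gt0.
Qed.

Lemma rbm_f_fourier x : f x = \sum_T fhat T * chi R T x.
Proof. by rewrite -[LHS]cube_fourier_inversion. Qed.

Definition log_odds u x : R :=
  \sum_(T : {set 'I_n} | u \in T) 2 * fhat T * chi R (T :\ u) x.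

Lemma rbm_fB_setx u x : f (setx x u true) - f (setx x u false) = log_odds u x.
Proof.
rewrite !rbm_f_fourier -sumrB [LHS](bigID (fun T => u \in T))/= [X in _ + X]big1.
  rewrite addr0; apply: eq_bigr => T uT; rewrite !chi_setx// /spin; ring.
by move=> T uT; rewrite !chi_setx_notin// subrr.
Qed.

Lemma condpE u x : condp u x = sigmoid (log_odds u x).
Proof.
rewrite -rbm_fB_setx /Defs.condp !rbm_margE /sigmoid opprB expRB.
have := rbm_Z_gt0; have := expR_gt0 (f (setx x u true)).
have := expR_gt0 (f (setx x u false)) => exp_false0 exp_true0 Z0.
by field; rewrite ?lt0r_neq0 ?addr_gt0.
Qed.

Lemma condp_setx u x b : condp u (setx x u b) = condp u x.
Proof. by rewrite /Defs.condp !setx_setx. Qed.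

Lemma mean_rbm_marg_cond u (F : cube n -> R) :
  mean mu F = mean mu (fun x =>
    condp u x * F (setx x u true) + (1 - condp u x) * F (setx x u false)).
Proof.
apply: (@mulfI _ 2) => //; rewrite -!(@sum_setx _ _ _ u).
apply: eq_bigr => x _; rewrite !setx_setx !condp_setx /Defs.condp.
have marg_true0 := rbm_marg_gt0 (setx x u true).
have marg_false0 := rbm_marg_gt0 (setx x u false).
by field; rewrite lt0r_neq0// addr_gt0.
Qed.

Definition fourier_weights u (S : {set 'I_n}) : R := 2 * fhat (u |: S).

Lemma sum_norm_fhat_le_gamma u : \sum_(T : {set 'I_n} | u \in T) `|fhat T| <= gamma.
Proof. exact: (le_bigmax 0 (fun u => \sum_(T : {set 'I_n} | u \in T) `|fhat T|)). Qed.

Definition fourier_support u : {set {set 'I_n}} :=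
  [set T : {set 'I_n} | (u \in T) && (fhat T != 0)].

Lemma card_fourier_support_le_psi u : (#|fourier_support u| <= psi)%N.
Proof. exact: (@leq_bigmax _ (fun u => #|fourier_support u|)). Qed.

Section Regression.
Variables (nu : {set 'I_n}) (u : 'I_n).
Hypothesis unu : u \notin nu.

Lemma risk_condp w :
  risk mu nu u w = mean mu (fun x => softplus (dotz nu w x) - condp u x * dotz nu w x).
Proof.
rewrite /risk (mean_rbm_marg_cond u); apply: eq_mean => x.
rewrite /logistic_loss !setx_at !dotz_setx// /spin mulN1r opprK mul1r softplusN; ring.
Qed.

Lemma excess_risk_bregman w w' : risk mu nu u w - risk mu nu u w' = mean mu (fun x =>
  softplus_bregman (log_odds u x) (dotz nu w x) -
  softplus_bregman (log_odds u x) (dotz nu w' x)).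
Proof.
rewrite !risk_condp -meanB; apply: eq_mean => x.
rewrite condpE /softplus_bregman; ring.
Qed.

Lemma pred_err_le_excess_risk w w' :
  2 * pred_err J h g nu u w <= risk mu nu u w - risk mu nu u w' +
    mean mu (fun x => (dotz nu w' x - log_odds u x) ^+ 2 / 8).
Proof.
rewrite excess_risk_bregman -meanD -meanZ; apply: ler_mean => [|x].
  exact: is_pmf_rbm_marg.
have := softplus_bregman_ge (log_odds u x) (dotz nu w x).
have := softplus_bregman_le (log_odds u x) (dotz nu w' x).
by rewrite condpE -(sqrrN (_ - sigmoid _)) opprB; lra.
Qed.

Lemma dotz_fourier_weights x : dotz nu (fourier_weights u) x =
  \sum_(T : {set 'I_n} | (u \in T) && (T :\ u \subset nu)) 2 * fhat T * chi R (T :\ u) x.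
Proof.
rewrite /dotz (sum_subset_setU1 _ unu).
by apply: eq_bigr => T /andP[uT _]; rewrite /fourier_weights finset.setD1K.
Qed.

Lemma l1w_fourier_weights : l1w nu (fourier_weights u) <= 2 * gamma.
Proof.
rewrite /l1w (sum_subset_setU1 _ unu).
apply: (@le_trans _ _ (2 * \sum_(T : {set 'I_n} | u \in T) `|fhat T|)); last first.
  by rewrite ler_pM2l// sum_norm_fhat_le_gamma.
rewrite mulr_sumr big_mkcondr/=; apply: ler_sum => T uT.
by case: ifP => _; rewrite ?mulr_ge0// /fourier_weights finset.setD1K// normrM ger0_norm.
Qed.

Variable zeta : R.
Hypothesis zeta0 : 0 <= zeta.
Hypothesis nu_heavy : forall i, i != u ->
  (exists T, [/\ u \in T, i \in T & zeta <= `|fhat T|]) -> i \in nu.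

Lemma norm_fhat_le_zeta T : u \in T -> ~~ (T :\ u \subset nu) -> `|fhat T| <= zeta.
Proof.
move=> uT /fintype.subsetPn[i]; rewrite !inE => /andP[iu iT] inu.
by rewrite leNgt; apply: contra inu => /ltW zetaT; apply: nu_heavy => //; exists T.
Qed.

Lemma truncation_error x :
  `|dotz nu (fourier_weights u) x - log_odds u x| <= 2 * (zeta * psi%:R).
Proof.
pose dropped T := (u \in T) && ~~ (T :\ u \subset nu).
have -> : dotz nu (fourier_weights u) x - log_odds u x =
    - \sum_(T : {set 'I_n} | dropped T) 2 * fhat T * chi R (T :\ u) x.
  rewrite dotz_fourier_weights /log_odds.
  by rewrite [X in _ - X](bigID (fun T => T :\ u \subset nu))/= opprD addNKr.
rewrite normrN; apply: le_trans (ler_norm_sum _ _ _) _.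
apply: (@le_trans _ _ (\sum_(T in fourier_support u) 2 * zeta)).
  rewrite big_mkcond [leRHS]big_mkcond/=; apply: ler_sum => T _; rewrite inE.
  have [uT|uT] := boolP (u \in T); last by rewrite /dropped (negbTE uT).
  rewrite normrM norm_chi mulr1 normrM ger0_norm//=.
  have [->|_] := eqVneq (fhat T) 0; first by rewrite normr0 mulr0 if_same.
  case: ifPn => [/andP[_ /(norm_fhat_le_zeta uT)]|_]; last by rewrite mulr_ge0.
  by rewrite ler_pM2l.
rewrite sumr_const -[leLHS]mulr_natr -mulrA ler_pM2l// ler_wpM2l// ler_nat.
exact: card_fourier_support_le_psi.
Qed.

Lemma pred_err_le_fourier_excess_risk w :
  2 * pred_err J h g nu u w <=
  risk mu nu u w - risk mu nu u (fourier_weights u) + (zeta * psi%:R) ^+ 2 / 2.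
Proof.
apply: le_trans (pred_err_le_excess_risk w (fourier_weights u)) _; rewrite lerD2l.
apply: mean_le_cst => [|x]; first exact: is_pmf_rbm_marg.
have := truncation_error x.
rewrite -ler_sqr ?nnegrE ?mulr_ge0// real_normK ?num_real// exprMn; lra.
Qed.

End Regression.

Lemma notin_mrf_nbhd nu u : nu \subset mrf_nbhd J h g u -> u \notin nu.
Proof. by move=> nbhd; apply/negP => /(fintype.subsetP nbhd); rewrite inE eqxx. Qed.

Lemma card_sub_mrf_nbhd_le nu u : nu \subset mrf_nbhd J h g u ->
  (#|nu| <= rbm_D J h g)%N.
Proof.
move=> /subset_leq_card /leq_trans; apply.
exact: (@leq_bigmax _ (fun u => #|mrf_nbhd J h g u|)).
Qed.

Lemma rbm_gamma_ge0 : 0 <= gamma.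
Proof. exact: bigmax_ge_id. Qed.

Lemma zeta_psi_sqr_le (zeta eps : R) : 0 <= zeta -> 0 <= eps ->
  zeta * psi%:R * Num.sqrt (1 + expR (2 * gamma)) <= Num.sqrt eps ->
  2 * (zeta * psi%:R) ^+ 2 <= eps.
Proof.
move=> zeta0 eps0; have zeta_psi0 : 0 <= zeta * psi%:R by rewrite mulr_ge0.
rewrite -ler_sqr ?nnegrE ?mulr_ge0 ?sqrtr_ge0// exprMn !sqr_sqrtr ?addr_ge0 ?expR_ge0//.
have : 1 <= expR (2 * gamma) by rewrite -expR0 ler_expR mulr_ge0 ?rbm_gamma_ge0.
by have := sqr_ge0 (zeta * psi%:R); nra.
Qed.

Lemma proba_fourier_suboptimal_le nu u (delta eps : R) M :
  nu \subset mrf_nbhd J h g u -> 0 < delta -> 0 < eps ->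
  128 * gamma ^+ 2 * ln (8 * n%:R * 2 ^+ rbm_D J h g / delta) / eps ^+ 2 <= M%:R ->
  proba (iid mu M)
    (erm_suboptimal mu nu u (2 * gamma) eps (fourier_weights u)) <= delta / n%:R.
Proof.
move=> nbhd delta0 eps0; set q := _ / delta => M_large.
have n0 : 0 < n%:R :> R by rewrite ltr0n (leq_ltn_trans _ (ltn_ord u)).
have D0 : 0 < 2 ^+ rbm_D J h g :> R by rewrite exprn_gt0.
have q0 : 0 < q by rewrite divr_gt0 ?mulr_gt0.
apply: (@le_trans _ _ (2 * 2 ^+ #|nu| / q)).
  apply: proba_erm_suboptimal_le q0 _ => //; first exact: is_pmf_rbm_marg.
    exact/l1w_fourier_weights/notin_mrf_nbhd.
  by have -> : 32 * (2 * gamma) ^+ 2 = 128 * gamma ^+ 2 by ring.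
apply: (@le_trans _ _ (2 * 2 ^+ rbm_D J h g / q)).
  by rewrite ler_pM2r ?invr_gt0// ler_pM2l// ler_eXn2l ?ltr1n// (card_sub_mrf_nbhd_le nbhd).
have quotientE (a b d : R) : 0 < a -> 0 < b -> 0 < d ->
    2 * b / (8 * a * b / d) = d / a / 4.
  by move=> a0 b0 d0; field; rewrite !lt0r_neq0.
rewrite /q quotientE//.
by rewrite ler_pdivrMr// ler_pMr ?divr_gt0// ler1n.
Qed.

Lemma sample_probE M (E : {ffun 'I_M -> cube n} -> Prop) :
  sample_prob J h g E = proba (iid mu M) (fun s => `[< E s >]).
Proof. by []. Qed.

End RBM.

Theorem theorem9 (R : realType) :
  exists C : R, 0 < C /\
  forall (n m : nat) (J : 'I_n -> 'I_m -> R) (h : 'I_n -> R) (g : 'I_m -> R)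
         (delta eps zeta : R) (nbr : 'I_n -> {set 'I_n}) (M : nat),
    0 < delta -> 0 < eps -> 0 < zeta ->
    (forall u, nbr u \subset mrf_nbhd J h g u) ->
    (forall u i, i != u ->
       (exists T : {set 'I_n}, [/\ u \in T, i \in T & zeta <= `|fhat J h g T|]) ->
       i \in nbr u) ->
    C * rbm_gamma J h g ^+ 2
      * ln (8 * n%:R * 2 ^+ rbm_D J h g / delta) / eps ^+ 2 <= M%:R ->
    zeta * (rbm_psi J h g)%:R * Num.sqrt (1 + expR (2 * rbm_gamma J h g))
      <= Num.sqrt eps ->
    1 - delta <=
      sample_prob J h g (fun s : {ffun 'I_M -> cube n} =>
        forall (u : 'I_n) (w : {set 'I_n} -> R),
          is_erm (nbr u) u (2 * rbm_gamma J h g) s w ->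
          pred_err J h g (nbr u) u w <= eps).
Proof.
exists 128; split=> // n m J h g delta eps zeta nbr M delta0 eps0 zeta0 nbrs heavy M_large.
move=> /(zeta_psi_sqr_le (ltW zeta0) (ltW eps0)) zeta_small; rewrite sample_probE.
pose bad u := erm_suboptimal (M := M) (rbm_marg J h g) (nbr u) u
  (2 * rbm_gamma J h g) eps (fourier_weights J h g u).
apply: (proba_union_bound_uniform (is_pmf_iid M (is_pmf_rbm_marg J h g)) (bad := bad)).
- exact: ltW.
- by move=> u; rewrite card_ord; apply: proba_fourier_suboptimal_le.
move=> s /asboolP/existsNP[u /existsNP[w /not_implyP[erm_w /negP]]].
rewrite -ltNge => err; exists u; apply/asboolP; exists w; split=> //.
have := pred_err_le_fourier_excess_risk (notin_mrf_nbhd (nbrs u)) (ltW zeta0) (heavy u) w.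
by lra.
Qed.
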